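(* Let $X$ be a set of alternatives, let $\Pi$ be a PM-compatible and consistent permutation process over $X$, and let $f$ be an anonymous social choice correspondence. Then $f$ is strongly PM-efficient on the profiles of $\Pi$ if and only if $f$ verifies the Strict Condorcet Principle on the profiles of $\Pi$.
   Context: For a nonempty finite $A\subseteq X$, $S_A$ is the set of bijections $\sigma:A\to\{1,\dots,|A|\}$ (rankings); $a>_\sigma b$ means $\sigma(a)<\sigma(b)$. An anonymous preference profile over $A$ is a probability distribution $\pi$ on $S_A$. An (anonymous) social choice correspondence (SCC), also called a rule, $f$ assigns to every anonymous preference profile $\pi$ over every nonempty finite $A\subseteq X$ a nonempty subset $f(\pi)\subseteq A$. A permutation process $\Pi$ over $X$ assigns to each nonempty finite $A\subseteq X$ a probability distribution $\Pi(A)$ on $S_A$ (regarded as a profile over $A$). It is consistent if for all nonempty finite $B\subseteq A\subseteq X$, $\Pi(B)$ is the marginal of $\Pi(A)$: $\Pi(B)(\sigma')=\sum_{\sigma\in S_A:\sigma|_B=\sigma'}\Pi(A)(\sigma)$ for $\sigma'\in S_B$, where $\sigma|_B\in S_B$ is the ranking of $B$ induced by $\sigma$. PM-dominance: $a\rhd^{pm}_\pi b$ iff $\sum_{\sigma:a>_\sigma b}\pi(\sigma)\ge\sum_{\sigma:b>_\sigma a}\pi(\sigma)$. For $a,b\in X$, $a\rhd^{pm}_\Pi b$ iff $a\rhd^{pm}_{\Pi(A)}b$ for every finite $A\subseteq X$ containing $a,b$. $\Pi$ is PM-compatible if for every $A\subseteq X$ the restriction of $\rhd^{pm}_\Pi$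 to $A$ is a total preorder (transitive and complete). $f$ is strongly PM-efficient on the profiles of $\Pi$ if for every nonempty finite $A\subseteq X$, with $\pi=\Pi(A)$, and all $a,b\in A$ with $a\rhd^{pm}_\pi b$: if not $b\rhd^{pm}_\pi a$, then $b\notin f(\pi)$; and if $b\rhd^{pm}_\pi a$, then $b\in f(\pi)\iff a\in f(\pi)$. $f$ verifies the Strict Condorcet Principle on the profiles of $\Pi$ if for every nonempty finite $A\subseteq X$ such that the set $W=\{a\in A: a\rhd^{pm}_{\Pi(A)}b\ \text{for all } b\in A\}$ (alternatives that beat or tie with every other one) is nonempty, $f(\Pi(A))=W$. *)

(* Defs.v *)
(* classical_sets comes first so that set0 and the like are those of finset. *)
From mathcomp Require Import classical_sets reals.
From mathcomp Require Import all_boot all_order all_algebra.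
From mathcomp Require Import finmap.

Set Implicit Arguments.
Unset Strict Implicit.
Unset Printing Implicit Defensive.

Import Order.TTheory GRing.Theory Num.Theory.

Local Open Scope fset_scope.
Local Open Scope ring_scope.

(* Ranks are numbered from 0 instead of 1. An injection between finite sets of
   the same cardinality is a bijection (ranking_bij). *)
Definition ranking (X : choiceType) (A : {fset X}) : Type :=
  {s : {ffun A -> 'I_#|` A|} | injectiveb s}.

Definition prefers (X : choiceType) (A : {fset X}) (s : ranking A) : rel A :=
  fun a b => (val s a < val s b)%N.

Lemma ranking_bij (X : choiceType) (A : {fset X}) (s : ranking A) :
  bijective (val s).
Proof.
apply: inj_card_bij; first by apply/injectiveP; apply: (valP s).
by rewrite card_ord cardfE.
Qed.

Definition above (X : choiceType) (A B : {fset X}) (sBA : B `<=` A)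
    (s : ranking A) (b : B) : {set B} :=
  [set c : B | prefers s (fincl sBA c) (fincl sBA b)].

Lemma above_lt (X : choiceType) (A B : {fset X}) (sBA : B `<=` A)
    (s : ranking A) (b : B) : (#|above sBA s b| < #|` B|)%N.
Proof.
rewrite cardfE -cardsT; apply: proper_card; apply/properP.
by split; [apply: subsetT | exists b; rewrite !inE // /prefers ltnn].
Qed.

Lemma above_mono (X : choiceType) (A B : {fset X}) (sBA : B `<=` A)
    (s : ranking A) (b c : B) :
  (#|above sBA s b| < #|above sBA s c|)%N
  = prefers s (fincl sBA b) (fincl sBA c).
Proof.
have mono x y : prefers s (fincl sBA x) (fincl sBA y) ->
    (#|above sBA s x| < #|above sBA s y|)%N.
  move=> xy; apply: proper_card; apply/properP; split.
    by apply/subsetP => z; rewrite !inE => zx; apply: ltn_trans xy.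
  by exists x; rewrite !inE // /prefers ltnn.
apply/idP/idP => [|/mono //]; apply: contraTT.
rewrite -leqNgt {1}/prefers -leqNgt leq_eqVlt => /orP[/eqP e|/mono/ltnW //].
suff -> : b = c by [].
apply: val_inj; have /(bij_inj (ranking_bij s)) : val s (fincl sBA c)
  = val s (fincl sBA b) by apply: val_inj.
by move/(congr1 val).
Qed.

Lemma restr_inj (X : choiceType) (A B : {fset X}) (sBA : B `<=` A)
    (s : ranking A) :
  injectiveb [ffun b : B => Ordinal (above_lt sBA s b)].
Proof.
apply/injectiveP => b c; rewrite !ffunE => -[e].
have := above_mono sBA s b c; have := above_mono sBA s c b.
rewrite e ltnn /prefers => /esym/negbT; rewrite -leqNgt => le1.
move=> /esym/negbT; rewrite -leqNgt => le2.
apply: val_inj; have /(bij_inj (ranking_bij s)) : val s (fincl sBA b)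
  = val s (fincl sBA c) by apply/val_inj/eqP; rewrite eqn_leq le1 le2.
by move/(congr1 val).
Qed.

(* The ranking s|_B of B induced by s: the rank of b is the number of elements
   of B that s ranks above b. *)
Definition restr (X : choiceType) (A B : {fset X}) (sBA : B `<=` A)
    (s : ranking A) : ranking B :=
  exist _ [ffun b : B => Ordinal (above_lt sBA s b)] (restr_inj sBA s).

Lemma prefers_restr (X : choiceType) (A B : {fset X}) (sBA : B `<=` A)
    (s : ranking A) (b c : B) :
  prefers (restr sBA s) b c = prefers s (fincl sBA b) (fincl sBA c).
Proof. by rewrite -above_mono /prefers /= !ffunE. Qed.

(* The fields are boolean so that profiles are equal as soon as their
   probabilities are. *)
Record profile (R : realType) (X : choiceType) (A : {fset X}) := Profile {
  prob :> {ffun ranking A -> R};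
  prob_ge0 : [forall s, 0 <= prob s];
  prob_sum1 : \sum_s prob s == 1 }.

(* Profiles do not identify voters, so every rule on them is anonymous. Here
   and in permutation processes the value at the empty set is immaterial:
   there is exactly one ranking, hence one profile, over it. *)
Record scc (R : realType) (X : choiceType) := Scc {
  scc_choice :> forall A : {fset X}, profile R A -> {set A};
  scc_nonempty : forall (A : {fset X}) (p : profile R A),
    A != fset0 -> scc_choice p != set0 }.

Definition permutation_process (R : realType) (X : choiceType) :=
  forall A : {fset X}, profile R A.

Definition consistent (R : realType) (X : choiceType)
    (Pi : permutation_process R X) : Prop :=
  forall (A B : {fset X}) (sBA : B `<=` A), B != fset0 ->
  forall s' : ranking B,
    Pi B s' = \sum_(s : ranking A | restr sBA s == s') Pi A s.

Definition pm_dom (R : realType) (X : choiceType) (A : {fset X})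
    (p : profile R A) : rel A :=
  fun a b => \sum_(s | prefers s b a) p s <= \sum_(s | prefers s a b) p s.

Definition pm_dom_process (R : realType) (X : choiceType)
    (Pi : permutation_process R X) (a b : X) : Prop :=
  forall (A : {fset X}) (aA : a \in A) (bA : b \in A),
    pm_dom (Pi A) [` aA] [` bA].

Definition total_preorder_on (X : Type) (Y : set X) (r : X -> X -> Prop) :
    Prop :=
  (forall a b c, Y a -> Y b -> Y c -> r a b -> r b c -> r a c) /\
  (forall a b, Y a -> Y b -> r a b \/ r b a).

Definition pm_compatible (R : realType) (X : choiceType)
    (Pi : permutation_process R X) : Prop :=
  forall Y : set X, total_preorder_on Y (pm_dom_process Pi).

Definition strongly_pm_efficient (R : realType) (X : choiceType)
    (Pi : permutation_process R X) (f : scc R X) : Prop :=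
  forall A : {fset X}, A != fset0 ->
  forall a b : A, pm_dom (Pi A) a b ->
    (~~ pm_dom (Pi A) b a -> b \notin f A (Pi A)) /\
    (pm_dom (Pi A) b a -> (b \in f A (Pi A) <-> a \in f A (Pi A))).

Definition condorcet_set (R : realType) (X : choiceType) (A : {fset X})
    (p : profile R A) : {set A} :=
  [set a : A | [forall b : A, pm_dom p a b]].

Definition strict_condorcet (R : realType) (X : choiceType)
    (Pi : permutation_process R X) (f : scc R X) : Prop :=
  forall A : {fset X}, A != fset0 ->
    condorcet_set (Pi A) != set0 -> f A (Pi A) = condorcet_set (Pi A).

(* Main.v *)
(* By consistency, pairwise majority between a and b is the same on every menu
   containing a and b, so PM-compatibility makes it a total preorder on each
   menu. The Condorcet set is then the nonempty top class of that preorder. *)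
Require Import Defs.
From mathcomp Require Import reals.
From mathcomp Require Import all_boot all_order all_algebra.
From mathcomp Require Import finmap.

Local Open Scope fset_scope.
Local Open Scope ring_scope.

(** Restriction to [B] keeps the order of [b] and [c], so the rankings of [A] on the right split
    into fibres of [restr sBA] over the rankings on the left. Consistency gives the mass of each
    fibre. *)
Lemma consistent_prefers_sum {R : realType} {X : choiceType}
    {Pi : permutation_process R X} {A B : {fset X}} (sBA : B `<=` A) (b c : B) :
  consistent Pi -> B != fset0 ->
  \sum_(s | prefers s b c) Pi B s
    = \sum_(s | prefers s (fincl sBA b) (fincl sBA c)) Pi A s.
Proof.
move=> hcons B0.
rewrite (partition_big (restr sBA) (fun s' => prefers s' b c)) /=; last first.
  by move=> s; rewrite prefers_restr.
apply: eq_bigr => s' s'bc; rewrite (hcons A B sBA B0); apply: eq_bigl => s.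
by rewrite andb_idl // => /eqP s's; rewrite -prefers_restr s's.
Qed.

Lemma consistent_pm_dom {R : realType} {X : choiceType}
    {Pi : permutation_process R X} {A B : {fset X}} (sBA : B `<=` A) (b c : B) :
  consistent Pi ->
  pm_dom (Pi B) b c = pm_dom (Pi A) (fincl sBA b) (fincl sBA c).
Proof.
move=> hcons; have B0 : B != fset0 by apply/fset0Pn; exists (val b); apply: valP.
by rewrite /pm_dom !(consistent_prefers_sum sBA _ _ hcons B0).
Qed.

(** This turns a quantifier over all menus into a check on a single one, so that PM-compatibility,
    stated for [pm_dom_process], can be used inside a given menu. *)
Lemma pm_dom_processP {R : realType} {X : choiceType}
    {Pi : permutation_process R X} {A : {fset X}} (a b : A) :
  consistent Pi ->
  pm_dom_process Pi (val a) (val b) <-> pm_dom (Pi A) a b.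
Proof.
move=> hcons; split=> [/(_ A (valP a) (valP b))|ab C aC bC].
  by rewrite !fsetsubE.
(* [A] and [C] need not be nested; both are compared with the two-element menu that they share. *)
set B := [fset val a; val b].
have sub (D : {fset X}) : val a \in D -> val b \in D -> B `<=` D.
  by move=> aD bD; apply/fsubsetP => x; rewrite !inE => /orP[] /eqP ->.
have sBA := sub A (valP a) (valP b); have sBC := sub C aC bC.
have aB : val a \in B by rewrite !inE eqxx.
have bB : val b \in B by rewrite !inE eqxx orbT.
have := consistent_pm_dom sBC [` aB] [` bB] hcons.
rewrite (consistent_pm_dom sBA _ _ hcons).
have -> : fincl sBA [` aB] = a by apply: val_inj.
have -> : fincl sBA [` bB] = b by apply: val_inj.
have -> : fincl sBC [` aB] = [` aC] by apply: val_inj.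
have -> : fincl sBC [` bB] = [` bC] by apply: val_inj.
by move=> <-.
Qed.

Section PMPreorder.
Context {R : realType} {X : choiceType} {Pi : permutation_process R X}.
Hypotheses (hcompat : pm_compatible Pi) (hcons : consistent Pi).

Lemma pm_dom_trans (A : {fset X}) : transitive (pm_dom (Pi A)).
Proof.
move=> b a c /(pm_dom_processP _ _ hcons) ab /(pm_dom_processP _ _ hcons) bc.
apply/(pm_dom_processP _ _ hcons).
(* Taking all of [X] as the subset makes the membership conditions trivial. *)
by have [trans _] := hcompat classical_sets.setT; apply: trans ab bc.
Qed.

Lemma pm_dom_total (A : {fset X}) : total (pm_dom (Pi A)).
Proof.
move=> a b; have [_ tot] := hcompat classical_sets.setT.
by apply/orP; case: (tot (val a) (val b) I I) => /(pm_dom_processP _ _ hcons);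
  [left | right].
Qed.

(** A total preorder on a nonempty finite set has a greatest element. *)
Lemma condorcet_set_neq0 (A : {fset X}) :
  A != fset0 -> condorcet_set (Pi A) != set0.
Proof.
case/fset0Pn => x xA; apply/set0Pn.
have refl : reflexive (pm_dom (Pi A)).
  by move=> a; have := pm_dom_total A a a; rewrite orbb.
have [a _ amax] := extremumP id refl (@pm_dom_trans A) (@pm_dom_total A)
  (isT : predT [` xA]).
by exists a; rewrite inE; apply/forallP => b; apply: amax.
Qed.

End PMPreorder.

Theorem theorem2 (R : realType) (X : choiceType)
    (Pi : permutation_process R X) (f : scc R X)
    (hcompat : pm_compatible Pi) (hcons : consistent Pi) :
  strongly_pm_efficient Pi f <-> strict_condorcet Pi f.
Proof.
split=> [eff A A0 _|cond A A0 a b ab].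
  (* An alternative outside the Condorcet set fails against some [c]; by totality [c] dominates it
     strictly, and efficiency excludes it. *)
  have fW b : b \in f A (Pi A) -> b \in condorcet_set (Pi A).
    rewrite inE; apply: contraLR; rewrite negb_forall => /existsP[c nbc].
    have cb : pm_dom (Pi A) c b.
      by have := pm_dom_total hcompat hcons A b c; rewrite (negbTE nbc).
    by have [/(_ nbc)] := eff A A0 c b cb.
  apply/setP => w; apply/idP/idP => [/fW //|wW].
  (* Some [a] is chosen, hence lies in the Condorcet set by [fW]. So [a] and [w] tie, and efficiency
     makes [w] chosen too. *)
  have /set0Pn[a fa] := scc_nonempty f (Pi A) A0.
  move: wW (fW a fa); rewrite !inE => /forallP/(_ a) wa /forallP/(_ w) aw.
  by have [_ /(_ wa)[_ ->]] := eff A A0 a w aw.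
rewrite (cond A A0 (condorcet_set_neq0 hcompat hcons A A0)) !inE.
split=> [nba|ba]; first by rewrite negb_forall; apply/existsP; exists a.
(* Tied alternatives dominate the same alternatives, by transitivity. *)
by split=> /forallP W; apply/forallP => c;
  [apply: pm_dom_trans ab (W c) | apply: pm_dom_trans ba (W c)].
Qed.
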